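(* Let $(\mathcal T,[1],\Delta)$ be a triangulated category, $\xi$ a proper class of triangles, and $(\mathcal X,\mathcal Y)$ a complete cotorsion pair in $\mathcal T$ with respect to $\xi$. Then the following are equivalent: (1) $(\mathcal X,\mathcal Y)$ is hereditary; (2) $\mathcal X$ is closed under the hokernel of $\xi$-proper epimorphisms; (3) $\mathcal Y$ is closed under the hocokernel of $\xi$-proper monomorphisms.
   Context: $(\mathcal T,[1],\Delta)$ denotes a triangulated category with suspension autoequivalence $[1]$ (quasi-inverse $[-1]$) and class $\Delta$ of (distinguished) triangles. A triangle $X\xrightarrow{u}Y\xrightarrow{v}Z\xrightarrow{w}X[1]$ is splitting if $w=0$. A class $\xi\subseteq\Delta$ is a proper class of triangles if: (i) it contains all splitting triangles; (ii) it is closed under isomorphisms of triangles, finite coproducts and suspensions (if $X\xrightarrow{u}Y\xrightarrow{v}Z\xrightarrow{w}X[1]$ is in $\xi$ then so is $X[i]\xrightarrow{(-1)^iu[i]}Y[i]\xrightarrow{(-1)^iv[i]}Z[i]\xrightarrow{(-1)^iw[i]}X[i+1]$ for all $i\in\mathbb Z$); (iii) it is closed under base changes (if $X\to Y\to Z\xrightarrow{w}X[1]$ is in $\xi$ and $\alpha:Z'\to Z$ is any morphism, then the triangle $X\to Y'\to Z'\xrightarrow{w\alpha}X[1]$ is in $\xi$) and cobase changes (if moreover $\beta:X\to X'$ is any morphism, then the triangle $X'\to Y'\to Z\xrightarrow{\beta[1]w}X'[1]$ is in $\xi$); (iv) it is saturated: for any triangle $X\to Y\to Z\xrightarrow{w}X[1]$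 and any morphism $\alpha:Z'\to Z$ embedded in a triangle $X'\to Z'\xrightarrow{\alpha}Z\to X'[1]$ in $\xi$, if the base change $X\to Y'\to Z'\xrightarrow{w\alpha}X[1]$ is in $\xi$, then $X\to Y\to Z\xrightarrow{w}X[1]$ is in $\xi$. $\mathrm{Ext}_\xi(X,Y)$ is the abelian group (under Baer sum) of equivalence classes of triangles $Y\to E\to X\to Y[1]$ in $\xi$, two such triangles being equivalent if there is a morphism of triangles between them which is the identity on $Y$ and on $X$; the zero element is the class of the splitting triangle. A pair $(\mathcal X,\mathcal Y)$ of classes of objects is a cotorsion pair with respect to $\xi$ if $\mathcal Y=\{Z\mid \mathrm{Ext}_\xi(X,Z)=0\ \forall X\in\mathcal X\}$ and $\mathcal X=\{Z\mid \mathrm{Ext}_\xi(Z,Y)=0\ \forall Y\in\mathcal Y\}$. It is complete if for each $T\in\mathcal T$ there are triangles $Y\to X\to T\to Y[1]$ and $T\to Y'\to X'\to T[1]$ in $\xi$ with $X,X'\in\mathcal X$, $Y,Y'\in\mathcal Y$. ''$\mathcal X$ is closed under the hokernel of $\xi$-proper epimorphisms'' means: if $K\to X_1\to X_2\to K[1]$ is a triangle in $\xi$ with $X_1,X_2\in\mathcal X$, then $K\in\mathcal X$. ''$\mathcal Y$ is closed under the hocokernel of $\xi$-proper monomorphisms'' means: if $Y_1\to Y_2\to C\to Y_1[1]$ is a triangle in $\xi$ with $Y_1,Y_2\in\mathcal Y$, then $C\in\mathcal Y$. A cotorsion pair is hereditary if both of these closure conditions hold. *)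

(* Defs.v *)
From HB Require Import structures.
From mathcomp Require Import all_boot all_order all_algebra.
Set Implicit Arguments.
Unset Strict Implicit.
Unset Printing Implicit Defensive.
Import GRing.Theory.
Local Open Scope ring_scope.

Record preadditive := Preadditive {
  obj :> Type;
  hom : obj -> obj -> zmodType;
  idm : forall X, hom X X;
  compm : forall X Y Z, hom Y Z -> hom X Y -> hom X Z;
  comp1m : forall X Y (f : hom X Y), compm (idm Y) f = f;
  compm1 : forall X Y (f : hom X Y), compm f (idm X) = f;
  compmA : forall W X Y Z (h : hom Y Z) (g : hom X Y) (f : hom W X),
    compm h (compm g f) = compm (compm h g) f;
  compmDl : forall X Y Z (g g' : hom Y Z) (f : hom X Y),
    compm (g + g') f = compm g f + compm g' f;
  compmDr : forall X Y Z (g : hom Y Z) (f f' : hom X Y),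
    compm g (f + f') = compm g f + compm g f'
}.

Arguments hom {p} X Y.
Arguments idm {p} X.
Arguments compm {p X Y Z} g f.

Declare Scope cat_scope.
Delimit Scope cat_scope with cat.
Notation "X ~> Y" := (hom X Y) (at level 60, no associativity) : cat_scope.
Notation "g \oc f" := (compm g f) (at level 40, left associativity) : cat_scope.
Local Open Scope cat_scope.

Definition is_iso (C : preadditive) (X Y : C) (f : X ~> Y) : Prop :=
  exists g : Y ~> X, g \oc f = idm X /\ f \oc g = idm Y.

Definition is_zero_obj (C : preadditive) (Z : C) : Prop :=
  (forall (X : C) (f : X ~> Z), f = 0) /\ (forall (X : C) (f : Z ~> X), f = 0).

Definition is_coproduct (C : preadditive) (n : nat) (X : 'I_n -> C) (S : C)
    (inj : forall k, X k ~> S) : Prop :=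
  forall (Y : C) (f : forall k, X k ~> Y),
    exists! g : S ~> Y, forall k, g \oc inj k = f k.

Record add_functor (C D : preadditive) := AddFunctor {
  fobj :> C -> D;
  fmap : forall X Y : C, {additive (X ~> Y) -> (fobj X ~> fobj Y)};
  fmap1 : forall X : C, fmap X X (idm X) = idm (fobj X);
  fmapM : forall (X Y Z : C) (g : Y ~> Z) (f : X ~> Y),
    fmap X Z (g \oc f) = fmap Y Z g \oc fmap X Y f
}.

Arguments fmap {C D} F {X Y} : rename.

(* An additive category with an additive autoequivalence [1] = shift and a
   chosen quasi-inverse [-1] = unshift.  The natural isomorphisms
   unitS : X -> X[1][-1] and counitS : X[-1][1] -> X satisfy the zigzag
   identities: every equivalence can be so normalised, and without them the
   identification of X[1][-1] with X[-1][1] would be off by an arbitrary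
   natural automorphism (for instance a sign). *)
Record shift_category := ShiftCategory {
  scat :> preadditive;
  (* n = 0 provides a zero object *)
  finite_coproducts : forall (n : nat) (X : 'I_n -> scat),
    exists (S : scat) (inj : forall k, X k ~> S), is_coproduct inj;
  shift : add_functor scat scat;
  unshift : add_functor scat scat;
  unitS : forall X : scat, X ~> unshift (shift X);
  unitSV : forall X : scat, unshift (shift X) ~> X;
  counitS : forall X : scat, shift (unshift X) ~> X;
  counitSV : forall X : scat, X ~> shift (unshift X);
  unitS_nat : forall (X Y : scat) (f : X ~> Y),
    unitS Y \oc f = fmap unshift (fmap shift f) \oc unitS X;
  counitS_nat : forall (X Y : scat) (f : X ~> Y),
    counitS Y \oc fmap shift (fmap unshift f) = f \oc counitS X;
  unitSK : forall X, unitSV X \oc unitS X = idm X;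
  unitSVK : forall X, unitS X \oc unitSV X = idm (unshift (shift X));
  counitSK : forall X, counitSV X \oc counitS X = idm (shift (unshift X));
  counitSVK : forall X, counitS X \oc counitSV X = idm X;
  zigzagl : forall X,
    counitS (shift X) \oc fmap shift (unitS X) = idm (shift X);
  zigzagr : forall X,
    fmap unshift (counitS X) \oc unitS (unshift X) = idm (unshift X)
}.

Notation "X [1]" := (shift _ X)
  (at level 2, left associativity, format "X [1]") : cat_scope.
Notation "f [1]m" := (fmap (shift _) f)
  (at level 2, left associativity, format "f [1]m") : cat_scope.
Notation "X [-1]" := (unshift _ X)
  (at level 2, left associativity, format "X [-1]") : cat_scope.
Notation "f [-1]m" := (fmap (unshift _) f)
  (at level 2, left associativity, format "f [-1]m") : cat_scope.

(* An arbitrary diagram X -> Y -> Z -> X[1]; the distinguished ones are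
   singled out below. *)
Record triangle (C : shift_category) := Triangle {
  triX : C;
  triY : C;
  triZ : C;
  triu : triX ~> triY;
  triv : triY ~> triZ;
  triw : triZ ~> triX[1]
}.

Arguments Triangle {C triX triY triZ} triu triv triw.

Definition tri_morphism (C : shift_category) (T T' : triangle C)
    (a : triX T ~> triX T') (b : triY T ~> triY T') (c : triZ T ~> triZ T')
    : Prop :=
  [/\ b \oc triu T = triu T' \oc a,
      c \oc triv T = triv T' \oc b
    & a[1]m \oc triw T = triw T' \oc c].

Definition tri_isomorphic (C : shift_category) (T T' : triangle C) : Prop :=
  exists (a : triX T ~> triX T') (b : triY T ~> triY T')
         (c : triZ T ~> triZ T'),
    [/\ tri_morphism a b c, is_iso a, is_iso b & is_iso c].

Definition tri_is_coproduct (C : shift_category) (n : nat)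
    (T : 'I_n -> triangle C) (S : triangle C) : Prop :=
  exists (a : forall k, triX (T k) ~> triX S)
         (b : forall k, triY (T k) ~> triY S)
         (c : forall k, triZ (T k) ~> triZ S),
    [/\ forall k, tri_morphism (a k) (b k) (c k),
        is_coproduct a, is_coproduct b & is_coproduct c].

Definition tri_shift (C : shift_category) (T : triangle C) : triangle C :=
  Triangle (- (triu T)[1]m) (- (triv T)[1]m) (- (triw T)[1]m).

(* w[-1] lands in X[1][-1], which is identified with X and then with
   X[-1][1]. *)
Definition tri_unshift (C : shift_category) (T : triangle C) : triangle C :=
  Triangle (- (triu T)[-1]m) (- (triv T)[-1]m)
    (- (counitSV (triX T) \oc (unitSV (triX T) \oc (triw T)[-1]m))).

(* X[i] is the iterate of [1] or [-1]; by additivity the three maps are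
   (-1)^i u[i], (-1)^i v[i] and (-1)^i w[i]. *)
Definition tri_suspension (C : shift_category) (i : int) (T : triangle C)
    : triangle C :=
  match i with
  | Posz n => iter n (@tri_shift C) T
  | Negz n => iter n.+1 (@tri_unshift C) T
  end.

Record triangulated_category := TriangulatedCategory {
  tcat :> shift_category;
  distinguished : triangle tcat -> Prop;
  TR1_iso : forall T T' : triangle tcat,
    tri_isomorphic T T' -> distinguished T -> distinguished T';
  TR1_id : forall X Z : tcat, is_zero_obj Z ->
    distinguished (Triangle (idm X) (0 : X ~> Z) (0 : Z ~> X[1]));
  TR1_cone : forall (X Y : tcat) (u : X ~> Y),
    exists (Z : tcat) (v : Y ~> Z) (w : Z ~> X[1]),
      distinguished (Triangle u v w);
  TR2 : forall (X Y Z : tcat) (u : X ~> Y) (v : Y ~> Z) (w : Z ~> X[1]),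
    distinguished (Triangle u v w) <->
    distinguished (Triangle v w (- u[1]m));
  TR3 : forall (T T' : triangle tcat)
      (a : triX T ~> triX T') (b : triY T ~> triY T'),
    distinguished T -> distinguished T' ->
    b \oc triu T = triu T' \oc a ->
    exists c : triZ T ~> triZ T', tri_morphism a b c;
  TR4 : forall (X Y Z X' Y' Z' : tcat) (u : X ~> Y) (v : Y ~> Z)
      (j : Y ~> Z') (k : Z' ~> X[1])
      (l : Z ~> X') (i : X' ~> Y[1])
      (m : Z ~> Y') (n : Y' ~> X[1]),
    distinguished (Triangle u j k) ->
    distinguished (Triangle v l i) ->
    distinguished (Triangle (v \oc u) m n) ->
    exists (f : Z' ~> Y') (g : Y' ~> X'),
      [/\ distinguished (Triangle f g (j[1]m \oc i)),
          f \oc j = m \oc v /\ n \oc f = k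
        & g \oc m = l /\ i \oc g = u[1]m \oc n]
}.

Section ProperClasses.

Variable C : triangulated_category.
Implicit Types (xi : triangle C -> Prop) (T : triangle C).

Definition splitting T : Prop := distinguished T /\ triw T = 0.

(* The (co)base change is determined up to isomorphism by its third map, so
   "the" triangle on that map is rendered by quantifying over all of them. *)
Record proper_class xi : Prop := ProperClass {
  pc_distinguished : forall T, xi T -> distinguished T;
  pc_splitting : forall T, splitting T -> xi T;
  pc_iso : forall T T', tri_isomorphic T T' -> xi T -> xi T';
  pc_coproduct : forall (n : nat) (T : 'I_n -> triangle C) (S : triangle C),
    tri_is_coproduct T S -> (forall k, xi (T k)) -> xi S;
  pc_suspension : forall (i : int) T, xi T -> xi (tri_suspension i T);
  pc_base_change : forall (X Y Z Y' Z' : C)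
      (u : X ~> Y) (v : Y ~> Z) (w : Z ~> X[1]) (alpha : Z' ~> Z)
      (u' : X ~> Y') (v' : Y' ~> Z'),
    xi (Triangle u v w) ->
    distinguished (Triangle u' v' (w \oc alpha)) ->
    xi (Triangle u' v' (w \oc alpha));
  pc_cobase_change : forall (X Y Z X' Y' : C)
      (u : X ~> Y) (v : Y ~> Z) (w : Z ~> X[1]) (beta : X ~> X')
      (u' : X' ~> Y') (v' : Y' ~> Z),
    xi (Triangle u v w) ->
    distinguished (Triangle u' v' (beta[1]m \oc w)) ->
    xi (Triangle u' v' (beta[1]m \oc w));
  pc_saturated : forall (X Y Z X' Y' Z' : C)
      (u : X ~> Y) (v : Y ~> Z) (w : Z ~> X[1])
      (a : X' ~> Z') (alpha : Z' ~> Z) (c : Z ~> X'[1])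
      (u' : X ~> Y') (v' : Y' ~> Z'),
    distinguished (Triangle u v w) ->
    xi (Triangle a alpha c) ->
    distinguished (Triangle u' v' (w \oc alpha)) ->
    xi (Triangle u' v' (w \oc alpha)) ->
    xi (Triangle u v w)
}.

(* A triangle Y -> E -> X -> Y[1] in xi, representing an element of
   Ext_xi(X, Y). *)
Record extension xi (X Y : C) := Extension {
  extE : C;
  extu : Y ~> extE;
  extv : extE ~> X;
  extw : X ~> Y[1];
  ext_xi : xi (Triangle extu extv extw)
}.

Definition ext_triangle xi (X Y : C) (e : extension xi X Y) : triangle C :=
  Triangle (extu e) (extv e) (extw e).

Definition ext_equiv xi (X Y : C) (e e' : extension xi X Y) : Prop :=
  exists phi : extE e ~> extE e',
    @tri_morphism C (ext_triangle e) (ext_triangle e') (idm Y) phi (idm X).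

(* Ext_xi(X, Y) = 0: every equivalence class is the zero element of the Baer
   group, namely the class of a splitting triangle.  The Baer sum itself does
   not enter the vanishing of the group. *)
Definition Ext_eq0 xi (X Y : C) : Prop :=
  forall e : extension xi X Y,
    exists e0 : extension xi X Y, splitting (ext_triangle e0) /\ ext_equiv e e0.

Definition cotorsion_pair xi (XX YY : C -> Prop) : Prop :=
  (forall Z, YY Z <-> (forall X, XX X -> Ext_eq0 xi X Z)) /\
  (forall Z, XX Z <-> (forall Y, YY Y -> Ext_eq0 xi Z Y)).

Definition complete_pair xi (XX YY : C -> Prop) : Prop :=
  forall A : C,
    (exists (Y X : C) (u : Y ~> X) (v : X ~> A) (w : A ~> Y[1]),
       [/\ XX X, YY Y & xi (Triangle u v w)]) /\
    (exists (Y' X' : C) (u : A ~> Y') (v : Y' ~> X') (w : X' ~> A[1]),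
       [/\ XX X', YY Y' & xi (Triangle u v w)]).

Definition hokernel_closed xi (XX : C -> Prop) : Prop :=
  forall (K X1 X2 : C) (u : K ~> X1) (v : X1 ~> X2) (w : X2 ~> K[1]),
    xi (Triangle u v w) -> XX X1 -> XX X2 -> XX K.

Definition hocokernel_closed xi (YY : C -> Prop) : Prop :=
  forall (Y1 Y2 K : C) (u : Y1 ~> Y2) (v : Y2 ~> K) (w : K ~> Y1[1]),
    xi (Triangle u v w) -> YY Y1 -> YY Y2 -> YY K.

Definition hereditary xi (XX YY : C -> Prop) : Prop :=
  hokernel_closed xi XX /\ hocokernel_closed xi YY.

End ProperClasses.

(* Main.v *)
(** Write phantom w when w : Z ~> X[1] is the third map of a triangle in xi;
    then Ext_xi(Z, X) = 0 means that every such w vanishes, and phantom maps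
    form an ideal by base and cobase change.

    Suppose XX is closed under hokernels, let Y1 -> Y2 -> K -> Y1[1] be in xi
    with Y1, Y2 in YY, and let K -> E -> X -> K[1] be in xi with X in XX and
    third map w.  Choose an XX-approximation X' -> E by completeness.
    Saturation makes X' -> E -> X a proper epimorphism, so its hokernel L lies
    in XX, and w factors as X -> L[1] -> K[1] with X -> L[1] phantom.
    The composite L -> K -> Y1[1] is phantom, hence 0, so L -> K factors through
    Y2 and w factors through a phantom map X -> Y2[1], which is 0.
    The converse is dual, once saturation is dualised. *)
Require Import Defs.
From mathcomp Require Import all_boot all_order all_algebra.
Set Implicit Arguments.
Unset Strict Implicit.
Unset Printing Implicit Defensive.
Import GRing.Theory.
Local Open Scope ring_scope.
Local Open Scope cat_scope.

(** * Zero and opposite maps *)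

Section Preadditive.

Variable C : preadditive.

Lemma comp0m (X Y Z : C) (f : X ~> Y) : (0 : Y ~> Z) \oc f = 0.
Proof. by apply: (addrI (0 \oc f)); rewrite -compmDl !addr0. Qed.

Lemma compm0 (X Y Z : C) (g : Y ~> Z) : g \oc (0 : X ~> Y) = 0.
Proof. by apply: (addrI (g \oc 0)); rewrite -compmDr !addr0. Qed.

Lemma compNm (X Y Z : C) (g : Y ~> Z) (f : X ~> Y) : (- g) \oc f = - (g \oc f).
Proof. by apply: (addrI (g \oc f)); rewrite -compmDl !subrr comp0m. Qed.

Lemma compmN (X Y Z : C) (g : Y ~> Z) (f : X ~> Y) : g \oc (- f) = - (g \oc f).
Proof. by apply: (addrI (g \oc f)); rewrite -compmDr !subrr compm0. Qed.

Lemma is_iso_idm (X : C) : is_iso (idm X).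
Proof. by exists (idm X); rewrite comp1m. Qed.

End Preadditive.

(** * Zero object; the shift is fully faithful *)

Section ShiftCategory.

Variable C : shift_category.

(** The empty coproduct controls maps out of [O] only; maps into [O] vanish because the identity of
    [O] does. *)
Lemma exists_zero_obj : exists O : C, is_zero_obj O.
Proof.
have X0 : 'I_0 -> C by case.
have [O [inj co]] := finite_coproducts X0.
have out0 (X : C) (f : O ~> X) : f = 0.
  have h0 (k : 'I_0) : X0 k ~> X by case: k.
  have [g [_ uniq_g]] := co X h0.
  by rewrite -(uniq_g f) ?(uniq_g 0) //; move=> [].
exists O; split=> [X f|//].
by rewrite -[f]comp1m (out0 _ (idm O)) comp0m.
Qed.

Lemma fmap_shift_unitS (X : C) : (unitS X)[1]m = counitSV X[1].
Proof.
by rewrite -[LHS]comp1m -counitSK -compmA zigzagl compm1.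
Qed.

Lemma fmap_shift_unitSV (X : C) : (unitSV X)[1]m = counitS X[1].
Proof.
rewrite -[RHS]compm1 -(fmap1 (shift C)) -unitSVK fmapM compmA zigzagl.
by rewrite comp1m.
Qed.

Lemma shift_full (X Y : C) (c : X[1] ~> Y[1]) : exists f : X ~> Y, f[1]m = c.
Proof.
exists (unitSV Y \oc (c[-1]m \oc unitS X)).
rewrite !fmapM fmap_shift_unitS fmap_shift_unitSV compmA counitS_nat.
by rewrite -compmA counitSVK compm1.
Qed.

Lemma shift_faithful (X Y : C) (f g : X ~> Y) : f[1]m = g[1]m -> f = g.
Proof.
move=> fg; rewrite -[f]comp1m -[g]comp1m -unitSK -!compmA !unitS_nat.
by rewrite fg.
Qed.

End ShiftCategory.

(** * Exactness and existence of distinguished triangles *)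

Section Triangulated.

Variable C : triangulated_category.

Lemma dist_fill (X Y Z X' Y' Z' : C)
    (u : X ~> Y) (v : Y ~> Z) (w : Z ~> X[1])
    (u' : X' ~> Y') (v' : Y' ~> Z') (w' : Z' ~> X'[1])
    (a : X ~> X') (b : Y ~> Y') :
  distinguished (Triangle u v w) -> distinguished (Triangle u' v' w') ->
  b \oc u = u' \oc a ->
  exists c : Z ~> Z', c \oc v = v' \oc b /\ a[1]m \oc w = w' \oc c.
Proof.
move=> d d' bu.
have [c [_ cv aw]] :=
  TR3 (T := Triangle u v w) (T' := Triangle u' v' w') d d' bu.
by exists c.
Qed.

Lemma dist_comp0 (X Y Z : C) (u : X ~> Y) (v : Y ~> Z) (w : Z ~> X[1]) :
  distinguished (Triangle u v w) -> v \oc u = 0.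
Proof.
move=> duvw; have [O zO] := exists_zero_obj C.
have d1 := TR1_id X zO.
have [|c [+ _]] := dist_fill (a := idm X) (b := u) d1 duvw; first by [].
by move=> <-; rewrite compm0.
Qed.

Lemma dist_rot (X Y Z : C) (u : X ~> Y) (v : Y ~> Z) (w : Z ~> X[1]) :
  distinguished (Triangle u v w) -> distinguished (Triangle v w (- u[1]m)).
Proof. by move=> /TR2. Qed.

(** By the hypothesis, [f] and the zero map start a morphism from the rotated triangle A -> 0 ->
    A[1] -> A[1]; fullness makes its third component the shift of the lift. *)
Lemma dist_lift (X Y Z A : C) (u : X ~> Y) (v : Y ~> Z) (w : Z ~> X[1])
    (f : A ~> Z) :
  distinguished (Triangle u v w) -> w \oc f = 0 -> exists g, f = v \oc g.
Proof.
move=> /TR2/TR2 d wf0; have [O zO] := exists_zero_obj C.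
have /TR2 d1 := TR1_id A zO.
have [|c [_]] :=
  dist_fill (a := f) (b := (0 : O ~> X[1])) d1 d; first by rewrite ?wf0 ?comp0m //.
have [g <-] := shift_full c.
rewrite fmap1 compmN compm1 compNm -fmapM => /oppr_inj/shift_faithful ->.
by exists g.
Qed.

(** Dual argument, mapping into the rotated triangle 0 -> A[1] -> A[1]. *)
Lemma dist_extend (X Y Z A : C) (u : X ~> Y) (v : Y ~> Z) (w : Z ~> X[1])
    (f : X ~> A) :
  distinguished (Triangle u v w) -> f[1]m \oc w = 0 ->
  exists g, f = g \oc u.
Proof.
move=> /TR2/TR2 d fw0; have [O zO] := exists_zero_obj C.
have /TR2/TR2 d1 := TR1_id A zO.
have [|c [+ _]] :=
  dist_fill (a := (0 : Z ~> O)) (b := f[1]m) d d1; first by rewrite ?fw0 ?comp0m //.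
have [g <-] := shift_full c.
rewrite fmap1 compmN compNm comp1m -fmapM => /oppr_inj/shift_faithful <-.
by exists g.
Qed.

Lemma dist_shift_comp0 (X Y Z : C) (u : X ~> Y) (v : Y ~> Z) (w : Z ~> X[1]) :
  distinguished (Triangle u v w) -> u[1]m \oc w = 0.
Proof.
by move=> /TR2/TR2/dist_comp0; rewrite compNm => /eqP; rewrite oppr_eq0 => /eqP.
Qed.

Lemma exists_hokernel (Y Z : C) (v : Y ~> Z) :
  exists (X : C) (u : X ~> Y) (w : Z ~> X[1]), distinguished (Triangle u v w).
Proof.
have [A [p [q d]]] := TR1_cone v.
(* The sign and [counitS] make [- u[1]m] equal to [q] transported to A[-1][1], as rotation
   demands. *)
have [u uE] := shift_full (- (q \oc counitS A)).
exists A[-1], u, (counitSV A \oc p); apply/TR2; apply: TR1_iso d.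
exists (idm Y), (idm Z), (counitSV A).
split; [|exact: is_iso_idm|exact: is_iso_idm|].
  split=> /=; rewrite ?fmap1 ?compm1 ?comp1m //.
  by rewrite uE opprK -compmA counitSVK compm1.
by exists (counitS A); rewrite counitSK counitSVK.
Qed.

Lemma exists_dist_on (X Z : C) (w : Z ~> X[1]) :
  exists (Y : C) (u : X ~> Y) (v : Y ~> Z), distinguished (Triangle u v w).
Proof.
have [Y [v [r d]]] := exists_hokernel w.
have [u uE] := shift_full (- r).
by exists Y, u, v; apply/TR2; rewrite uE opprK.
Qed.

(** After rotation, [q] and the identity of [Z] form a commuting square; its filler X'[1] -> X[1] is
    a shift by fullness. *)
Lemma hokernel_map (X Y Z X' Y' : C)
    (u : X ~> Y) (v : Y ~> Z) (w : Z ~> X[1])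
    (u' : X' ~> Y') (v' : Y' ~> Z) (w' : Z ~> X'[1]) (q : Y' ~> Y) :
  distinguished (Triangle u v w) -> distinguished (Triangle u' v' w') ->
  v \oc q = v' -> exists l : X' ~> X, l[1]m \oc w' = w.
Proof.
move=> /TR2 d /TR2 d' vq.
have [|c [+ _]] := dist_fill (a := q) (b := idm Z) d' d.
  by rewrite comp1m.
have [l <-] := shift_full c.
by rewrite compm1 => cw; exists l.
Qed.

(** * Phantom maps and cotorsion pairs *)

Section Phantom.

Variable xi : triangle C -> Prop.
Hypothesis hxi : proper_class xi.

Definition phantom (X Z : C) (w : Z ~> X[1]) : Prop :=
  exists (Y : C) (u : X ~> Y) (v : Y ~> Z), xi (Triangle u v w).

(** Equivalent extensions share their third map, and an extension with zero third map is itself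
    splitting. *)
Lemma Ext_eq0P (X Y : C) :
  Ext_eq0 xi X Y <-> forall w : X ~> Y[1], phantom w -> w = 0.
Proof.
split=> [ext0 w [E [u [v uvw]]] | w0 e].
  have [e0 [[_ /= w0] [phi [_ _ /=]]]] := ext0 (Extension uvw).
  by rewrite fmap1 comp1m w0 comp0m.
exists e; split.
  split; first exact: pc_distinguished (ext_xi e).
  by apply: w0; exists (extE e), (extu e), (extv e); exact: ext_xi.
by exists (idm _); split=> /=; rewrite ?fmap1 ?comp1m ?compm1.
Qed.

Lemma phantom0 (X Z : C) : phantom (0 : Z ~> X[1]).
Proof.
have [Y [u [v d]]] := exists_dist_on (0 : Z ~> X[1]).
by exists Y, u, v; apply: pc_splitting.
Qed.

Lemma phantom_compr (X Z Z' : C) (w : Z ~> X[1]) (f : Z' ~> Z) :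
  phantom w -> phantom (w \oc f).
Proof.
move=> [Y [u [v uvw]]]; have [Y' [u' [v' d]]] := exists_dist_on (w \oc f).
by exists Y', u', v'; apply: pc_base_change uvw d.
Qed.

(** Base change along the identity carries membership in [xi] from one triangle on [w] to any
    other. *)
Lemma phantom_dist (X Y Z : C) (u : X ~> Y) (v : Y ~> Z) (w : Z ~> X[1]) :
  distinguished (Triangle u v w) -> phantom w -> xi (Triangle u v w).
Proof.
move=> d [Y' [u' [v' x]]]; rewrite -[w]compm1 in d *.
exact: pc_base_change x d.
Qed.

Lemma phantom_compl (X X' Z : C) (w : Z ~> X[1]) (f : X ~> X') :
  phantom w -> phantom (f[1]m \oc w).
Proof.
move=> [Y [u [v uvw]]]; have [Y' [u' [v' d]]] := exists_dist_on (f[1]m \oc w).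
by exists Y', u', v'; apply: pc_cobase_change uvw d.
Qed.

Lemma phantom_saturated (X Z A B : C) (w : Z ~> X[1])
    (a : A ~> B) (f : B ~> Z) (c : Z ~> A[1]) :
  xi (Triangle a f c) -> phantom (w \oc f) -> phantom w.
Proof.
move=> afc [Y' [u' [v' x']]]; have [Y [u [v d]]] := exists_dist_on w.
exists Y, u, v; exact: pc_saturated d afc (pc_distinguished hxi x') x'.
Qed.

(* For the proper epimorphism e on the triangle of f[1] w, the map w e is killed
   by f[1], so it factors through the phantom c, and saturation applies to e. *)
Lemma phantom_cosaturated (X Z A B : C) (w : Z ~> X[1])
    (f : X ~> A) (b : A ~> B) (c : B ~> X[1]) :
  xi (Triangle f b c) -> phantom (f[1]m \oc w) -> phantom w.
Proof.
move=> fbc [Y [u [e x]]]; apply: (phantom_saturated x).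
have fwe0 : f[1]m \oc (w \oc e) = 0.
  by rewrite compmA (dist_comp0 (dist_rot (pc_distinguished hxi x))).
have [|g ->] :=
  dist_lift (f := w \oc e) (dist_rot (pc_distinguished hxi fbc)).
  by rewrite compNm fwe0 oppr0.
by apply: phantom_compr; exists A, f, b.
Qed.

Variables XX YY : C -> Prop.
Hypothesis hcot : cotorsion_pair xi XX YY.
Hypothesis hcomp : complete_pair xi XX YY.

Lemma phantom_cotorsion0 (X Y : C) (w : X ~> Y[1]) :
  XX X -> YY Y -> phantom w -> w = 0.
Proof. by move=> hX /hcot.1/(_ _ hX)/Ext_eq0P; apply. Qed.

Lemma hokernel_closed_hocokernel_closed :
  hokernel_closed xi XX -> hocokernel_closed xi YY.
Proof.
move=> hXX Y1 Y2 K s v t svt hY1 hY2; apply/hcot.1 => X hX.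
apply/Ext_eq0P => w [E [f [p fpw]]].
have [[Y' [X' [i [q [r [hX' _ iqr]]]]]] _] := hcomp E.
have [L [j [w' d]]] := exists_hokernel (p \oc q).
have dfpw := pc_distinguished hxi fpw.
have w'pq0 : w' \oc p \oc q = 0.
  by rewrite -compmA (dist_comp0 (dist_rot d)).
have phw' : phantom w'.
  (* Saturation along [p], then along [q], leaves only the zero map to check. *)
  apply: phantom_saturated fpw _; apply: phantom_saturated iqr _.
  by rewrite w'pq0; exact: phantom0.
have hL : XX L := hXX _ _ _ _ _ _ (phantom_dist d phw') hX' hX.
have [l lw'] := hokernel_map dfpw d erefl.
have tl0 : t \oc l = 0.
  apply: phantom_cotorsion0 hL hY1 _; apply: phantom_compr.
  by exists Y2, s, v.
have [m lvm] := dist_lift (pc_distinguished hxi svt) tl0.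
(* Now [w] is [v[1]m] after the phantom map [m[1]m \oc w'] from [X] to Y2[1]. *)
rewrite -lw' lvm fmapM -compmA.
rewrite (phantom_cotorsion0 hX hY2 (phantom_compl m phw')).
exact: compm0.
Qed.

Lemma hocokernel_closed_hokernel_closed :
  hocokernel_closed xi YY -> hokernel_closed xi XX.
Proof.
move=> hYY K X1 X2 k v t kvt hX1 hX2; apply/hcot.2 => Y hY.
apply/Ext_eq0P => w [E [f [p fpw]]].
have [_ [Y' [X' [g [q [r [hX' hY' gqr]]]]]]] := hcomp E.
(* The cone [M] of Y -> E -> Y' plays the dual role of [L]. *)
have [M [j [w' d]]] := TR1_cone (g \oc f).
have phw' : phantom w'.
  apply: phantom_cosaturated fpw _; apply: phantom_cosaturated gqr _.
  by rewrite compmA -fmapM (dist_shift_comp0 d); exact: phantom0.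
have hM : YY M := hYY _ _ _ _ _ _ (phantom_dist d phw') hY hY'.
(* The filler [c] from [K] to [M] factors [w] as [w' \oc c]. *)
have [|c [_]] :=
  dist_fill (a := idm Y) (b := g) (pc_distinguished hxi fpw) d;
    first by rewrite compm1.
rewrite fmap1 comp1m => ->.
have ct0 : c[1]m \oc t = 0.
  apply: phantom_cotorsion0 hX2 hM _; apply: phantom_compl.
  by exists X1, k, v.
have [m ->] := dist_extend (pc_distinguished hxi kvt) ct0.
rewrite compmA (phantom_cotorsion0 hX1 hY (phantom_compr m phw')).
exact: comp0m.
Qed.

End Phantom.
End Triangulated.

Theorem theorem1p5 (C : triangulated_category) (xi : triangle C -> Prop)
    (XX YY : C -> Prop)
    (hxi : proper_class xi)
    (hcot : cotorsion_pair xi XX YY)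
    (hcomp : complete_pair xi XX YY) :
  [<-> hereditary xi XX YY;
       hokernel_closed xi XX;
       hocokernel_closed xi YY].
Proof.
split; first by case.
split; first exact: hokernel_closed_hocokernel_closed.
by move=> hYY; split=> //; exact: hocokernel_closed_hokernel_closed hYY.
Qed.
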